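(* Let $\mathbb{F}$ be a field with involution $\overline{\,\cdot\,}$, let $m,n\ge 1$, let $x,y\in\mathbb{F}^m$ and $z,w\in\mathbb{F}^n$ be column vectors with all entries nonzero, let $a,b\in\mathbb{F}\setminus\{0\}$, and let $$M=\left[\begin{array}{cc|cc}0&x^T&a&0\\ y&0&0&0\\ \hline b&0&0&z^T\\ 0&0&w&0\end{array}\right]$$ (a square matrix of order $m+n+2$). Assume $x^Ty\neq 0$, $z^Tw=0$ and $\zeta:=x^Ty+ab\neq 0$, and that $M$ is Moore–Penrose invertible and dual core EP invertible (equivalently, the scalars $s=x^*x$, $u=y^*y$, $t=z^*z$, $v=w^*w$, $q=a\overline{a}+x^*x$, $\alpha=\zeta\overline{\zeta}+a\overline{a}\,z^*z$ are all nonzero). Then the GC inverse of $M$ is $$M^{\mathrm{GC}}=\left[\begin{array}{cc|cc}0&(u\zeta)^{-1}(x^Ty)y^*&a\zeta^{-1}&0\\ \alpha^{-1}\overline{\zeta}y&0&0&0\\ \hline \alpha^{-1}(b\overline{\zeta}+\overline{a}z^*z)&0&0&0\\ 0&\overline{a}(uq\zeta)^{-1}(x^Ty)wy^*&a\overline{a}(q\zeta)^{-1}w&0\end{array}\right].$$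
   Context: For a matrix $A=[a_{ij}]$ over a field $\mathbb{F}$ with involution $\overline{\,\cdot\,}$ (a field automorphism with $\overline{\overline{c}}=c$), $\overline{A}=[\overline{a_{ij}}]$ and $A^*=\overline{A}^{\,T}$. All $4\times4$ block matrices have rows and columns partitioned with sizes $1,m,1,n$; each $0$ is a zero block of the appropriate size. Matrices $M$ of the displayed form are the matrices whose associated digraph is a double star digraph, in canonical form. The Moore–Penrose inverse $A^\dagger$ is the unique $X$ (if it exists) with $AXA=A$, $XAX=X$, $(AX)^*=AX$, $(XA)^*=XA$. A square matrix $A$ is dual core EP invertible if there is $X$ with $A^{k+1}X=A^k$ for some nonnegative integer $k$, $X^2A=X$, $(XA)^*=XA$; such $X$ is unique, called the dual core EP inverse and denoted $A_{\mathrm{cEP}}$. When $A^\dagger$ and $A_{\mathrm{cEP}}$ exist, the generalized core (GC) inverse $A^{\mathrm{GC}}$ is the unique $X$ with $XAX=X$, $AX=A^2A_{\mathrm{cEP}}A^\dagger$, $XA=AA_{\mathrm{cEP}}$; explicitly $A^{\mathrm{GC}}=AA_{\mathrm{cEP}}A^\dagger$. *)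

(* Defs.v *)
From mathcomp Require Import all_boot all_order all_algebra.

Set Implicit Arguments.
Unset Strict Implicit.
Unset Printing Implicit Defensive.

Import GRing.Theory.
Local Open Scope ring_scope.

Definition ctmx (F : fieldType) (conj : involutive_rmorphism F) (p q : nat)
  (A : 'M[F]_(p, q)) : 'M[F]_(q, p) := map_mx conj A^T.

(* The scalars x^T y and x^* y, read off from the corresponding 1 x 1
   matrices. *)
Definition bdot (F : fieldType) (p : nat) (x y : 'cV[F]_p) : F :=
  (x^T *m y) ord0 ord0.

Definition hdot (F : fieldType) (conj : involutive_rmorphism F) (p : nat)
  (x y : 'cV[F]_p) : F :=
  (ctmx conj x *m y) ord0 ord0.

Definition is_MP_inverse (F : fieldType) (conj : involutive_rmorphism F)
  (p q : nat) (A : 'M[F]_(p, q)) (X : 'M[F]_(q, p)) : Prop :=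
  [/\ A *m X *m A = A,
      X *m A *m X = X,
      ctmx conj (A *m X) = A *m X
    & ctmx conj (X *m A) = X *m A].

Definition MP_invertible (F : fieldType) (conj : involutive_rmorphism F)
  (p q : nat) (A : 'M[F]_(p, q)) : Prop :=
  exists X, is_MP_inverse conj A X.

Definition is_dual_core_EP_inverse (F : fieldType)
  (conj : involutive_rmorphism F) (p : nat) (A X : 'M[F]_p) : Prop :=
  [/\ exists k : nat, A ^+ k.+1 *m X = A ^+ k,
      X ^+ 2 *m A = X
    & ctmx conj (X *m A) = X *m A].

Definition dual_core_EP_invertible (F : fieldType)
  (conj : involutive_rmorphism F) (p : nat) (A : 'M[F]_p) : Prop :=
  exists X, is_dual_core_EP_inverse conj A X.

(* The Moore-Penrose inverse D and the dual core EP inverse E are unique when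
   they exist, so the existential quantifiers merely name them. *)
Definition is_GC_inverse (F : fieldType) (conj : involutive_rmorphism F)
  (p : nat) (A X : 'M[F]_p) : Prop :=
  exists D E : 'M[F]_p,
    [/\ is_MP_inverse conj A D,
        is_dual_core_EP_inverse conj A E,
        X *m A *m X = X,
        A *m X = A ^+ 2 *m E *m D
      & X *m A = A *m E].

Definition double_star_mx (F : fieldType) (m n : nat)
  (x y : 'cV[F]_m) (z w : 'cV[F]_n) (a b : F) : 'M[F]_((1 + m) + (1 + n)) :=
  block_mx (block_mx 0    x^T
                     y    0)     (block_mx a%:M 0
                                           0    0)
           (block_mx b%:M 0
                     0    0)     (block_mx 0    z^T
                                           w    0).

(* Main.v *)
Require Import Defs.
From mathcomp Require Import all_boot all_order all_algebra.
From mathcomp Require Import ring.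

Set Implicit Arguments.
Unset Strict Implicit.
Unset Printing Implicit Defensive.

Import GRing.Theory.
Local Open Scope ring_scope.

(** The matrix [M] is bipartite: it exchanges the coordinates of the first
    centre and the second leaves with those of the first leaves and the second
    centre.  Everything rests on two row vectors, one on each side,
      [g = (0, x^T, a, 0)]  and  [h = (zeta, 0, 0, a z^T)].
    Because [z^T w = 0], they satisfy [g M = h] and [h M = zeta g], and
    [M^3 = (M f) g + f h] for the column [f = (0, y, b, 0)^T]; hence for
    [k >= 3] every power [M^k] has row space spanned by [g] and [h].

    Acting on row vectors from the right, the dual core EP inverse [E] is the
    orthogonal projection onto that row space followed by the inverse of [M] on
    it.  As [g] and [h] are orthogonal, with [g g^* = q] and [h h^* = alpha],
    this gives
      [E = (q zeta)^-1 g^* h + alpha^-1 h^* g]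
    when [q] and [alpha] are nonzero ([core_rows_dual_core_EP]).  Conversely,
    [E M] is hermitian, fixes [g] and [h], and factors through [M^3]; if [g] or
    [h] were isotropic, [M^3] would kill [g^*] or [h^*] while [E M] fixes it
    ([core_rows_anisotropic]).

    For the Moore-Penrose inverse, the entries of the explicit candidate
    [star_pinv] come from a full-rank factorisation of the two off-diagonal
    parts of [M].  Conversely, [M M^* c = 0] forces [M^* c = 0] when [M] is
    Moore-Penrose invertible, and the same for [M^*]; the row space of [M]
    contains [x^T] and [z^T] padded by zeros, the column space contains [y] and
    [w], and none of these vectors can then be isotropic ([star_MP_necessary]).

    Finally the GC inverse is [M E D] with [D] the Moore-Penrose inverse
    ([GC_inverse_unique]); expanding [E] turns it into
      [(q zeta)^-1 M g^* h D + alpha^-1 M h^* g D],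
    where the columns [M g^*], [M h^*] and the rows [h D], [g D] are short. *)

(** * Conjugate transposition *)

Lemma ctmxM (F : fieldType) (conj : involutive_rmorphism F) (p q r : nat)
  (A : 'M[F]_(p, q)) (B : 'M[F]_(q, r)) :
  ctmx conj (A *m B) = ctmx conj B *m ctmx conj A.
Proof. by rewrite /ctmx trmx_mul map_mxM. Qed.

Lemma ctmxK (F : fieldType) (conj : involutive_rmorphism F) (p q : nat)
  (A : 'M[F]_(p, q)) : ctmx conj (ctmx conj A) = A.
Proof. by apply/matrixP => i j; rewrite !mxE rmorphK. Qed.

Lemma ctmx0 (F : fieldType) (conj : involutive_rmorphism F) (p q : nat) :
  ctmx conj (0 : 'M[F]_(p, q)) = 0.
Proof. by rewrite /ctmx trmx0 map_mx0. Qed.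

Lemma ctmxD (F : fieldType) (conj : involutive_rmorphism F) (p q : nat)
  (A B : 'M[F]_(p, q)) : ctmx conj (A + B) = ctmx conj A + ctmx conj B.
Proof. by rewrite /ctmx linearD map_mxD. Qed.

Lemma ctmxZ (F : fieldType) (conj : involutive_rmorphism F) (p q : nat)
  (c : F) (A : 'M[F]_(p, q)) : ctmx conj (c *: A) = conj c *: ctmx conj A.
Proof. by rewrite /ctmx linearZ map_mxZ. Qed.

Lemma ctmx_scalar (F : fieldType) (conj : involutive_rmorphism F) (p : nat)
  (c : F) : ctmx conj (c%:M : 'M_p) = (conj c)%:M.
Proof. by rewrite /ctmx tr_scalar_mx map_scalar_mx. Qed.

Lemma ctmx_row (F : fieldType) (conj : involutive_rmorphism F) (p q r : nat)
  (A : 'M[F]_(p, q)) (B : 'M[F]_(p, r)) :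
  ctmx conj (row_mx A B) = col_mx (ctmx conj A) (ctmx conj B).
Proof. by rewrite /ctmx tr_row_mx map_col_mx. Qed.

Lemma ctmx_col (F : fieldType) (conj : involutive_rmorphism F) (p q r : nat)
  (A : 'M[F]_(p, r)) (B : 'M[F]_(q, r)) :
  ctmx conj (col_mx A B) = row_mx (ctmx conj A) (ctmx conj B).
Proof. by rewrite /ctmx tr_col_mx map_row_mx. Qed.

Lemma ctmx_block (F : fieldType) (conj : involutive_rmorphism F)
  (p1 p2 q1 q2 : nat) (A : 'M[F]_(p1, q1)) (B : 'M[F]_(p1, q2))
  (C : 'M[F]_(p2, q1)) (D : 'M[F]_(p2, q2)) :
  ctmx conj (block_mx A B C D)
  = block_mx (ctmx conj A) (ctmx conj C) (ctmx conj B) (ctmx conj D).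
Proof. by rewrite /ctmx tr_block_mx map_block_mx. Qed.

(** * Moore-Penrose inverses *)

Lemma MP_inverse_unique (F : fieldType) (conj : involutive_rmorphism F)
  (p q : nat) (A : 'M[F]_(p, q)) (X Y : 'M[F]_(q, p)) :
  is_MP_inverse conj A X -> is_MP_inverse conj A Y -> X = Y.
Proof.
move=> [AXA XAX hAX hXA] [AYA YAY hAY hYA].
have eqAX : A *m X = A *m Y.
  by rewrite -hAX -{1}AYA -mulmxA ctmxM hAX hAY mulmxA AXA.
have eqXA : X *m A = Y *m A.
  rewrite -hXA -{1}AYA -mulmxA mulmxA ctmxM hXA hYA.
  by rewrite -!mulmxA (mulmxA A X) AXA.
by rewrite -XAX eqXA -mulmxA eqAX mulmxA.
Qed.

(** Since [A X] is hermitian and fixes the columns of [A], each of them is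
    recovered from its inner products with the columns of [A]; in particular
    the column space of [A] contains no nonzero vector orthogonal to it. *)
Lemma MP_cancel_left (F : fieldType) (conj : involutive_rmorphism F)
  (p q r : nat) (A : 'M[F]_(p, q)) (c : 'M[F]_(q, r)) :
  MP_invertible conj A -> ctmx conj (A *m c) *m A = 0 -> A *m c = 0.
Proof.
move=> [X [AXA _ hAX _]] h.
rewrite -[A *m c](ctmxK conj).
have -> : A *m c = A *m X *m (A *m c) by rewrite mulmxA AXA.
by rewrite ctmxM hAX mulmxA h mul0mx ctmx0.
Qed.

Lemma MP_cancel_right (F : fieldType) (conj : involutive_rmorphism F)
  (p q r : nat) (A : 'M[F]_(p, q)) (c : 'M[F]_(r, p)) :
  MP_invertible conj A -> A *m ctmx conj (c *m A) = 0 -> c *m A = 0.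
Proof.
move=> [X [AXA _ _ hXA]] h.
rewrite -[c *m A](ctmxK conj).
have -> : c *m A = (c *m A) *m (X *m A) by rewrite -mulmxA (mulmxA A) AXA.
by rewrite ctmxM hXA -mulmxA h mulmx0 ctmx0.
Qed.

(** * Dual core EP and GC inverses *)

Lemma expmx_shrink (F : fieldType) (p : nat) (A X : 'M[F]_p) (j : nat) :
  X ^+ 2 *m A = X -> X ^+ j.+1 *m A ^+ j = X.
Proof.
move=> h; elim: j => [|j IH]; first by rewrite expr1 expr0 mulmx1.
rewrite exprS [A ^+ _]exprSr -[X * _]/(X *m _) -[A ^+ j * _]/(A ^+ j *m _).
by rewrite -mulmxA (mulmxA (X ^+ _)) IH mulmxA -[X *m X]/(X ^+ 2).
Qed.

Lemma expmx_grow (F : fieldType) (p : nat) (A X : 'M[F]_p) (k i : nat) :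
  A ^+ k.+1 *m X = A ^+ k -> A ^+ (i + k).+1 *m X = A ^+ (i + k).
Proof.
move=> h; rewrite -addnS !exprD -[_ * A ^+ k.+1]/(_ *m A ^+ k.+1).
by rewrite -mulmxA h.
Qed.

(** Write [X] as [X^(k+1) A^k]: the exponent is then large enough for the
    defining equation of [Y] to apply.  With [Y = X] this says [X A X = X], and
    with [X] and [Y] exchanged it shows that the hermitian idempotents [X A] and
    [Y A] absorb each other, whence uniqueness. *)
Lemma dual_core_EP_absorb (F : fieldType) (conj : involutive_rmorphism F)
  (p : nat) (A X Y : 'M[F]_p) :
  is_dual_core_EP_inverse conj A X -> is_dual_core_EP_inverse conj A Y ->
  X *m A *m Y = X.
Proof.
move=> [_ XXA _] [[k Yk] _ _].
rewrite -{1}(expmx_shrink k XXA) -(mulmxA _ _ A).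
rewrite -[A ^+ k *m A]/(A ^+ k * A) -exprSr -mulmxA Yk.
exact: expmx_shrink.
Qed.

Lemma dual_core_EP_inverse_unique (F : fieldType)
  (conj : involutive_rmorphism F) (p : nat) (A X Y : 'M[F]_p) :
  is_dual_core_EP_inverse conj A X -> is_dual_core_EP_inverse conj A Y ->
  X = Y.
Proof.
move=> hX hY.
have XAY := dual_core_EP_absorb hX hY.
have YAX := dual_core_EP_absorb hY hX.
have YAY := dual_core_EP_absorb hY hY.
case: hX hY => [_ _ hXA] [_ _ hYA].
have eqXA : X *m A = Y *m A.
  by rewrite -hXA -{1}XAY -(mulmxA _ Y A) ctmxM hXA hYA mulmxA YAX.
by rewrite -XAY eqXA YAY.
Qed.

(** For uniqueness, write [X = X A X]: the prescribed values of [X A] and [A X]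
    give [X = (A E) (A E D)], and [A E] is idempotent. *)
Lemma GC_inverse_unique (F : fieldType) (conj : involutive_rmorphism F)
  (p : nat) (A D E : 'M[F]_p) :
  is_MP_inverse conj A D -> is_dual_core_EP_inverse conj A E ->
  unique (is_GC_inverse conj A) (A *m E *m D).
Proof.
move=> hD hE; have EAE := dual_core_EP_absorb hE hE.
have AEAE : A *m E *m A *m E = A *m E by rewrite -!mulmxA (mulmxA E) EAE.
have AED : A *m E *m D *m A = A *m E.
  case: (hD) (hE) => ADA _ _ _ [_ + _]; move: (E ^+ 2) => S SA.
  by rewrite -!mulmxA -SA -mulmxA (mulmxA A D) ADA.
split.
  exists D, E; split => //; first by rewrite AED !mulmxA AEAE.
  by rewrite -[A ^+ 2]/(A *m A) !mulmxA.
move=> X [D' [E' [hD' hE' XAX AX XA]]].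
rewrite (MP_inverse_unique hD' hD) in AX.
rewrite (dual_core_EP_inverse_unique hE' hE) in AX XA.
by rewrite -[RHS]XAX -(mulmxA X) AX -[A ^+ 2]/(A *m A) !mulmxA XA AEAE.
Qed.

(** * Matrices whose large powers have a two-dimensional row space *)

(** The rows [g] and [h] form an orthogonal basis of the row space of [A^3], on
    which [A] acts by [g -> h -> zeta g].  The candidate is the orthogonal
    projection onto that space followed by the inverse of this action. *)
Lemma core_rows_dual_core_EP (F : fieldType) (conj : involutive_rmorphism F)
  (p : nat) (A : 'M[F]_p) (f : 'cV[F]_p) (g h : 'rV[F]_p) (zeta q r : F) :
  zeta != 0 -> q != 0 -> r != 0 ->
  g *m A = h -> h *m A = zeta *: g -> A *m (A *m f) = zeta *: f ->
  A ^+ 3 = A *m f *m g + f *m h ->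
  h *m ctmx conj g = 0 -> g *m ctmx conj g = q%:M ->
  h *m ctmx conj h = r%:M ->
  is_dual_core_EP_inverse conj A
    ((q * zeta)^-1 *: (ctmx conj g *m h) + r^-1 *: (ctmx conj h *m g)).
Proof.
move=> z0 q0 r0 gA hA AAf A3 hg gg hh.
have gh : g *m ctmx conj h = 0 by rewrite -[g](ctmxK conj) -ctmxM hg ctmx0.
have conj_fix (v : 'rV[F]_p) c : v *m ctmx conj v = c%:M -> conj c = c.
  move=> vv; have := congr1 (fun B => ctmx conj B ord0 ord0) vv.
  by rewrite ctmxM ctmxK vv ctmx_scalar !mxE.
set E := (X in is_dual_core_EP_inverse _ _ X).
have EA : E *m A = q^-1 *: (ctmx conj g *m g) + r^-1 *: (ctmx conj h *m h).
  rewrite /E mulmxDl -!scalemxAl -!mulmxA gA hA -scalemxAr scalerA.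
  by congr (_ *: _ + _); field; apply/andP.
have gE : g *m E = zeta^-1 *: h.
  rewrite /E mulmxDr -!scalemxAr !mulmxA gh gg mul0mx scaler0 addr0.
  by rewrite mul_scalar_mx scalerA; congr (_ *: _); field; rewrite z0.
have hE : h *m E = g.
  rewrite /E mulmxDr -!scalemxAr !mulmxA hg hh mul0mx scaler0 add0r.
  by rewrite mul_scalar_mx scalerA mulVf // scale1r.
split.
- exists 3; rewrite exprS -[A * _]/(A *m _) A3 mulmxDr mulmxDl !mulmxA.
  rewrite -(mulmxA A A f) AAf -!scalemxAl -!mulmxA gE hE.
  by rewrite -scalemxAr scalerA divff // scale1r addrC mulmxA.
- rewrite -[E ^+ 2]/(E *m E) -mulmxA EA mulmxDr -!scalemxAr /E !mulmxDl.
  rewrite -!scalemxAl -!mulmxA !(mulmxA _ (ctmx conj _)) hg gh gg hh.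
  rewrite !mul0mx !mulmx0 !scaler0 addr0 add0r !mul_scalar_mx -!scalemxAr.
  rewrite !scalerA.
  by rewrite addrC; congr (_ *: _ + _ *: _); field; rewrite ?z0 ?q0 ?r0.
- rewrite EA ctmxD !ctmxZ !ctmxM !ctmxK !fmorphV /=.
  by rewrite (conj_fix _ _ gg) (conj_fix _ _ hh).
Qed.

(** An eigenvector [g] of [A^2] is a multiple of [g A^(2i)] for every [i], and
    for [i] large [A^(2i) E A = A^(2i)]; taking adjoints moves the fixed vector
    to the other side of the hermitian matrix [E A]. *)
Lemma core_row_fixed (F : fieldType) (conj : involutive_rmorphism F)
  (p : nat) (A E : 'M[F]_p) (g : 'rV[F]_p) (zeta : F) :
  zeta != 0 -> is_dual_core_EP_inverse conj A E ->
  g *m A *m A = zeta *: g -> E *m A *m ctmx conj g = ctmx conj g.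
Proof.
move=> z0 [[k Ak] _ hEA] gAA.
suff gEA : g *m (E *m A) = g by rewrite -{2}gEA ctmxM hEA.
have gpow i : g *m A ^+ (i + i) = zeta ^+ i *: g.
  elim: i => [|i IH]; first by rewrite addn0 !expr0 mulmx1 scale1r.
  rewrite addSn addnS -addn2 exprD -[_ * _]/(A ^+ (i + i) *m (A *m A)).
  by rewrite mulmxA IH -!scalemxAl mulmxA gAA scalerA -exprSr.
have h : g *m A ^+ (k.+1 + k.+1) *m (E *m A) = g *m A ^+ (k.+1 + k.+1).
  rewrite addnS mulmxA -(mulmxA g) (expmx_grow _ Ak) -mulmxA.
  by rewrite -[_ *m A]/(A ^+ (k.+1 + k) * A) -exprSr.
move: h; rewrite !gpow -scalemxAl; apply: scalerI.
by rewrite expf_neq0.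
Qed.

(** If [g] were isotropic, [g^*] would be orthogonal to both rows that factor
    [A^3], so [E A], a left multiple of [A^3], would kill the vector that it
    fixes.  The same argument applies to [h]. *)
Lemma core_rows_anisotropic (F : fieldType) (conj : involutive_rmorphism F)
  (p : nat) (A : 'M[F]_p) (f : 'cV[F]_p) (g h : 'rV[F]_p) (zeta q r : F) :
  zeta != 0 -> dual_core_EP_invertible conj A -> g != 0 -> h != 0 ->
  g *m A = h -> h *m A = zeta *: g ->
  A ^+ 3 = A *m f *m g + f *m h ->
  h *m ctmx conj g = 0 -> g *m ctmx conj g = q%:M ->
  h *m ctmx conj h = r%:M ->
  q != 0 /\ r != 0.
Proof.
move=> z0 [E hE] g0 h0 gA hA A3 hg gg hh.
have gh : g *m ctmx conj h = 0 by rewrite -[g](ctmxK conj) -ctmxM hg ctmx0.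
have [S EE] : exists S, E *m A = S *m A ^+ 3.
  case: (hE) => _ EEA _; exists (E ^+ 4 *m A); rewrite -{1}(expmx_shrink 3 EEA).
  by rewrite -mulmxA -[A ^+ 3 *m A]/(A ^+ 3 * A) -exprSr (exprS A) mulmxA.
have kill (v : 'rV_p) : v *m A *m A = zeta *: v -> g *m ctmx conj v = 0 ->
    h *m ctmx conj v = 0 -> v = 0.
  move=> vAA gv hv; rewrite -[v](ctmxK conj).
  rewrite -(core_row_fixed z0 hE vAA) EE A3 -mulmxA mulmxDl.
  by rewrite -!mulmxA gv hv !mulmx0 addr0 !mulmx0 ctmx0.
split; apply/eqP => e0.
  move/eqP: g0; apply; apply: kill; rewrite ?gA ?hA //.
  by rewrite gg e0 raddf0.
move/eqP: h0; apply; apply: kill; rewrite ?hA -?scalemxAl ?gA //.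
by rewrite hh e0 raddf0.
Qed.

(** * Dot products and blocks *)

Lemma bdotE (F : fieldType) (p : nat) (x y : 'cV[F]_p) :
  x^T *m y = (bdot x y)%:M.
Proof. exact: mx11_scalar. Qed.

Lemma hdotE (F : fieldType) (conj : involutive_rmorphism F) (p : nat)
  (x y : 'cV[F]_p) : ctmx conj x *m y = (hdot conj x y)%:M.
Proof. exact: mx11_scalar. Qed.

Lemma hdot_trE (F : fieldType) (conj : involutive_rmorphism F) (p : nat)
  (x : 'cV[F]_p) : x^T *m ctmx conj x^T = (hdot conj x x)%:M.
Proof.
rewrite [LHS]mx11_scalar /hdot !mxE; congr (_%:M).
by apply: eq_bigr => i _; rewrite !mxE mulrC.
Qed.

Lemma hdot_conj (F : fieldType) (conj : involutive_rmorphism F) (p : nat)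
  (c : 'cV[F]_p) : conj (hdot conj c c) = hdot conj c c.
Proof.
have := congr1 (fun B => ctmx conj B ord0 ord0) (hdotE conj c c).
by rewrite ctmxM ctmxK hdotE ctmx_scalar !mxE.
Qed.

Lemma exists_dot (F : fieldType) (p : nat) (v : 'cV[F]_p) (d : F) :
  v != 0 -> exists c : 'cV[F]_p, v^T *m c = d%:M.
Proof.
case/cV0Pn=> i vi; exists ((d / v i ord0) *: delta_mx i ord0).
rewrite -scalemxAr -colE [col _ _]mx11_scalar !mxE scale_scalar_mx.
by rewrite divfK.
Qed.

(** The rules for whole blocks come first, so that a product of block matrices
    is never split into its block rows. *)
Definition mxsimp := (mulmx_block, add_block_mx, scale_block_mx, mul_block_col,
  mul_row_block, mul_col_row, mul_row_col, add_row_mx, add_col_mx,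
  scale_row_mx, scale_col_mx, mulmx0, mul0mx, addr0, add0r, scaler0,
  mul_scalar_mx, mul_mx_scalar, raddf0).

(** * The double star matrix *)

Section DoubleStar.

Variables (F : fieldType) (conj : involutive_rmorphism F) (m n : nat).
Variables (x y : 'cV[F]_m) (z w : 'cV[F]_n) (a b : F).

Local Notation M := (double_star_mx x y z w a b).
Local Notation zeta := (bdot x y + a * b).
Local Notation s := (hdot conj x x).
Local Notation u := (hdot conj y y).
Local Notation t := (hdot conj z z).
Local Notation v := (hdot conj w w).
Local Notation q := (a * conj a + s).
Local Notation alpha := (zeta * conj zeta + a * conj a * t).

(** When [z^T w = 0] and [zeta != 0], the rows [star_g] and [star_h] span the row
    space of [M^k] for [k >= 3]. *)
Definition star_g : 'rV[F]_((1 + m) + (1 + n)) :=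
  row_mx (row_mx 0 x^T) (row_mx a%:M 0).

Definition star_h : 'rV[F]_((1 + m) + (1 + n)) :=
  row_mx (row_mx zeta%:M 0) (row_mx 0 (a *: z^T)).

Definition star_f : 'cV[F]_((1 + m) + (1 + n)) :=
  col_mx (col_mx 0 y) (col_mx b%:M 0).

Definition star_dual_core_EP : 'M[F]_((1 + m) + (1 + n)) :=
  (q * zeta)^-1 *: (ctmx conj star_g *m star_h)
  + alpha^-1 *: (ctmx conj star_h *m star_g).

(** The columns [ctmx conj x^T] and [ctmx conj z^T] are the entrywise conjugates
    of [x] and [z].  If [M = P Q] with [P] of full column rank and [Q] of full
    row rank, the inverse is [Q^* (Q Q^* )^-1 (P^* P)^-1 P^*]; the entries come
    from applying this to [[y, 0; b, z^T] = [y, 0; b, 1] [1, 0; 0, z^T]] and to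
    [[x^T, a; 0, w] = [1, 0; 0, w] [x^T, a; 0, 1]]. *)
Definition star_pinv : 'M[F]_((1 + m) + (1 + n)) :=
  block_mx
    (block_mx 0 (u^-1 *: ctmx conj y) (s^-1 *: ctmx conj x^T) 0)
    (block_mx 0 0 0 (- (a / (s * v)) *: (ctmx conj x^T *m ctmx conj w)))
    (block_mx 0 0 0 (- (b / (t * u)) *: (ctmx conj z^T *m ctmx conj y)))
    (block_mx 0 (v^-1 *: ctmx conj w) (t^-1 *: ctmx conj z^T) 0).

Local Notation g := star_g.
Local Notation h := star_h.
Local Notation f := star_f.
Local Notation D := star_pinv.

Lemma star_g_mul : g *m M = h.
Proof.
rewrite /star_g /double_star_mx !mxsimp bdotE.
by rewrite scale_scalar_mx -raddfD.
Qed.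

Lemma star_h_mul : bdot z w = 0 -> h *m M = zeta *: g.
Proof.
move=> zw; rewrite /star_h /star_g /double_star_mx !mxsimp.
rewrite -?scalemxAl ?bdotE zw.
by rewrite !scale_scalar_mx mulr0 raddf0 addr0.
Qed.

Lemma star_mul_f : M *m f = col_mx (col_mx zeta%:M 0) (col_mx 0 (b *: w)).
Proof.
rewrite /star_f /double_star_mx !mxsimp -?scalemxAl ?bdotE.
by rewrite scale_scalar_mx -raddfD.
Qed.

Lemma star_mul_mul_f : bdot z w = 0 -> M *m (M *m f) = zeta *: f.
Proof.
move=> zw; rewrite star_mul_f /star_f /double_star_mx !mxsimp.
rewrite -?scalemxAl -?scalemxAr ?bdotE.
by rewrite zw raddf0 scaler0 addr0 !scale_scalar_mx (mulrC b).
Qed.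

Lemma star_cube : bdot z w = 0 -> M ^+ 3 = M *m f *m g + f *m h.
Proof.
move=> zw; rewrite star_mul_f !exprS expr0 mulr1 -![_ * _]/(_ *m _).
rewrite /star_f /star_g /star_h /double_star_mx !mxsimp.
rewrite !(mulmxA x^T) !(mulmxA z^T) -?scalemxAr !bdotE zw.
rewrite !scale_scalar_mx ?mulr0 ?raddf0 ?addr0 -!raddfD /=.
rewrite !mul_scalar_mx !mul_mx_scalar -?scalemxAr ?scale0r ?addr0 !scalerA.
rewrite -scalerDl -?scalemxAl mul0mx addr0 !scale_scalar_mx -raddfD /=.
rewrite (mulrC b a).
by have -> : a * bdot x y + a * (a * b) = zeta * a by ring.
Qed.

Lemma star_g_norm : g *m ctmx conj g = q%:M.
Proof.
rewrite /star_g !ctmx_row !ctmx0 ctmx_scalar !mxsimp hdot_trE scale_scalar_mx.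
by rewrite -raddfD; congr (_%:M); rewrite addrC.
Qed.

Lemma star_h_norm : h *m ctmx conj h = alpha%:M.
Proof.
rewrite /star_h !ctmx_row !ctmx0 ctmxZ ctmx_scalar !mxsimp.
rewrite -scalemxAr -scalemxAl.
by rewrite hdot_trE !scale_scalar_mx -raddfD mulrA (mulrC (conj a) a).
Qed.

Lemma star_hg_orthogonal : h *m ctmx conj g = 0.
Proof. by rewrite /star_h /star_g !ctmx_row !ctmx0 ctmx_scalar !mxsimp. Qed.

Lemma star_mul_g_adj :
  M *m ctmx conj g = col_mx (col_mx q%:M 0) (col_mx 0 (conj a *: w)).
Proof.
rewrite /star_g /double_star_mx !ctmx_row !ctmx0 ctmx_scalar !mxsimp hdot_trE.
by rewrite scale_scalar_mx -raddfD addrC.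
Qed.

Lemma star_mul_h_adj :
  M *m ctmx conj h = col_mx (col_mx 0 (conj zeta *: y))
                            (col_mx (b * conj zeta + conj a * t)%:M 0).
Proof.
rewrite /star_h /double_star_mx !ctmx_row !ctmx0 ctmxZ ctmx_scalar !mxsimp.
by rewrite -scalemxAr hdot_trE !scale_scalar_mx -raddfD.
Qed.

Lemma star_dual_core_EPP :
  bdot z w = 0 -> zeta != 0 -> q != 0 -> alpha != 0 ->
  is_dual_core_EP_inverse conj M star_dual_core_EP.
Proof.
move=> zw zeta0 q0 alpha0.
apply: (core_rows_dual_core_EP (f := f)) => //.
- exact: star_g_mul.
- exact: star_h_mul.
- exact: star_mul_mul_f.
- exact: star_cube.
- exact: star_hg_orthogonal.
- exact: star_g_norm.
- exact: star_h_norm.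
Qed.

Lemma star_dual_core_EP_necessary :
  bdot z w = 0 -> zeta != 0 -> a != 0 -> dual_core_EP_invertible conj M ->
  q != 0 /\ alpha != 0.
Proof.
move=> zw zeta0 a0 EP.
apply: (core_rows_anisotropic zeta0 EP (f := f) (g := g) (h := h)).
- apply/eqP => /(congr1 (fun r => lsubmx (rsubmx r) ord0 ord0)).
  by rewrite row_mxKr row_mxKl !linear0 !mxE => /eqP; apply/negP.
- apply/eqP => /(congr1 (fun r => lsubmx (lsubmx r) ord0 ord0)).
  by rewrite !row_mxKl !linear0 !mxE => /eqP; apply/negP.
- exact: star_g_mul.
- exact: star_h_mul.
- exact: star_cube.
- exact: star_hg_orthogonal.
- exact: star_g_norm.
- exact: star_h_norm.
Qed.

Hypotheses (s0 : s != 0) (u0 : u != 0) (t0 : t != 0) (v0 : v != 0).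

Lemma star_mul_pinv :
  M *m D = block_mx
    (block_mx 1%:M 0 0 (u^-1 *: (y *m ctmx conj y))) 0 0
    (block_mx 1%:M 0 0 (v^-1 *: (w *m ctmx conj w))).
Proof.
rewrite /star_pinv /double_star_mx !mxsimp -?scalemxAl -?scalemxAr -?mulmxA.
rewrite !(mulmxA _ (ctmx conj _^T)) !hdot_trE.
rewrite !mul_scalar_mx !scalerA -!scalerDl !scale_scalar_mx.
have -> : - (a / (s * v)) * s + a / v = 0 by field; rewrite ?s0 ?v0.
have -> : b / u + - (b / (t * u)) * t = 0 by field; rewrite ?t0 ?u0.
by rewrite !scale0r !block_mx0 !mulVf.
Qed.

Lemma star_pinv_mul :
  D *m M = block_mx
    (block_mx 1%:M 0 0 (s^-1 *: (ctmx conj x^T *m x^T))) 0 0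
    (block_mx 1%:M 0 0 (t^-1 *: (ctmx conj z^T *m z^T))).
Proof.
rewrite /star_pinv /double_star_mx !mxsimp -?scalemxAl -?mulmxA.
rewrite !hdotE !mul_mx_scalar !scalerA -!scalerDl !scale_scalar_mx.
have -> : a / s + - (a / (s * v)) * v = 0 by field; rewrite ?s0 ?v0.
have -> : - (b / (t * u)) * u + b / t = 0 by field; rewrite ?t0 ?u0.
by rewrite !scale0r !block_mx0 !mulVf.
Qed.

Lemma star_pinvP : is_MP_inverse conj M D.
Proof.
rewrite /is_MP_inverse star_mul_pinv star_pinv_mul; split.
- rewrite /double_star_mx !mxsimp -!scalemxAl -!mulmxA !hdotE !mul_mx_scalar.
  by rewrite !scalerA !mulVf // !scale1r.
- rewrite /star_pinv !mxsimp -!scalemxAr -!scalemxAl -!mulmxA.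
  rewrite !(mulmxA _ (ctmx conj _^T)) !hdot_trE !mul_scalar_mx -!scalemxAr.
  by rewrite !mul_mx_scalar !scalerA !div1r !divfK.
- rewrite !ctmx_block !ctmx0 !ctmxZ !ctmxM !ctmxK !ctmx_scalar !fmorphV /=.
  by rewrite !hdot_conj rmorph1.
- rewrite !ctmx_block !ctmx0 !ctmxZ !ctmxM !ctmxK !ctmx_scalar !fmorphV /=.
  by rewrite !hdot_conj rmorph1.
Qed.

Lemma star_g_pinv : g *m D = row_mx (row_mx 1%:M 0) 0.
Proof.
rewrite /star_g /star_pinv !mxsimp -!scalemxAr mulmxA !hdot_trE.
rewrite mul_scalar_mx !scalerA -scalerDl.
have -> : - (a / (s * v)) * s + a / v = 0 by field; rewrite ?s0 ?v0.
by rewrite scale_scalar_mx mulVf // scale0r row_mx0.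
Qed.

Lemma star_h_pinv :
  h *m D = row_mx (row_mx 0 ((bdot x y / u) *: ctmx conj y)) (row_mx a%:M 0).
Proof.
rewrite /star_h /star_pinv !mxsimp -!scalemxAr -!scalemxAl mulmxA.
rewrite !hdot_trE mul_scalar_mx !scalerA -scalerDl scale_scalar_mx.
congr (row_mx (row_mx _ (_ *: _)) (row_mx (_%:M) _)).
  by field; rewrite ?t0 ?u0.
by field.
Qed.

Lemma star_GCE :
  zeta != 0 -> q != 0 -> alpha != 0 ->
  M *m star_dual_core_EP *m D
  = block_mx
      (block_mx 0 (((u * zeta)^-1 * bdot x y) *: ctmx conj y)
                ((alpha^-1 * conj zeta) *: y) 0)
      (block_mx (a * zeta^-1)%:M 0 0 0)
      (block_mx (alpha^-1 * (b * conj zeta + conj a * t))%:M 0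
                0 ((conj a * (u * q * zeta)^-1 * bdot x y)
                     *: (w *m ctmx conj y)))
      (block_mx 0 0 ((a * conj a * (q * zeta)^-1) *: w) 0).
Proof.
move=> zeta0 q0 alpha0; rewrite /star_dual_core_EP.
rewrite mulmxDr mulmxDl -!scalemxAr -!scalemxAl !mulmxA.
rewrite star_mul_g_adj star_mul_h_adj -!mulmxA star_g_pinv star_h_pinv.
rewrite !mxsimp -!scalemxAl -!scalemxAr !scalerA !scale_scalar_mx !mulr1.
have -> : (q * zeta)^-1 * q * (bdot x y / u) = (u * zeta)^-1 * bdot x y.
  by field; rewrite q0 zeta0 u0.
have -> : (q * zeta)^-1 * q * a = a / zeta by field; rewrite q0 zeta0.
have -> : (q * zeta)^-1 * conj a * (bdot x y / u)
          = conj a / (u * q * zeta) * bdot x y.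
  by field; rewrite q0 zeta0 u0.
by have -> : (q * zeta)^-1 * a * conj a = a * conj a / (q * zeta) by ring.
Qed.

End DoubleStar.

(** Each zero-padded vector below is the product of [M] with an explicit vector:
    one centre entry is [1], and the entries at the leaves of the other centre,
    whose edges are not all labelled by zero, cancel the contribution of the
    edge between the centres. *)
Lemma star_MP_necessary (F : fieldType) (conj : involutive_rmorphism F)
  (m n : nat) (x y : 'cV[F]_m) (z w : 'cV[F]_n) (a b : F) :
  x != 0 -> y != 0 -> z != 0 -> w != 0 ->
  MP_invertible conj (double_star_mx x y z w a b) ->
  [/\ hdot conj x x != 0, hdot conj y y != 0, hdot conj z z != 0
    & hdot conj w w != 0].
Proof.
have addr_scalar (c d : F) : c%:M + d%:M = (c + d)%:M :> 'M_1.
  by rewrite raddfD.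
move=> x0 y0 z0 w0 MP; set M := double_star_mx _ _ _ _ _ _ in MP.
have [cx xcx] := exists_dot (- a) x0.
have [cz zcz] := exists_dot (- b) z0.
have [cy ycy] := exists_dot (- b) y0.
have [cw wcw] := exists_dot (- a) w0.
have trdot p (c d : 'cV[F]_p) e : c^T *m d = e%:M -> d^T *m c = e%:M.
  by move=> h; apply: trmx_inj; rewrite trmx_mul trmxK h tr_scalar_mx.
split; apply/eqP => e0.
- move/eqP: x0; apply; apply: trmx_inj; rewrite trmx0.
  set c : 'rV_((1 + m) + (1 + n)) := row_mx (row_mx 1%:M 0) (row_mx 0 cw^T).
  have cM : c *m M = row_mx (row_mx 0 x^T) 0.
    rewrite /c /M /double_star_mx !mxsimp (trdot _ _ _ _ wcw).
    by rewrite !scale1r addr_scalar subrr raddf0 row_mx0.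
  have := MP_cancel_right MP (c := c).
  rewrite cM !ctmx_row !ctmx0 /M /double_star_mx !mxsimp.
  rewrite hdot_trE e0 raddf0 !col_mx0.
  move/(_ erefl)=> r0.
  by have := congr1 (fun r => rsubmx (lsubmx r)) r0;
    rewrite row_mxKl row_mxKr !linear0.
- move/eqP: y0; apply.
  set c : 'cV_((1 + m) + (1 + n)) := col_mx (col_mx 1%:M 0) (col_mx 0 cz).
  have cM : M *m c = col_mx (col_mx 0 y) 0.
    rewrite /c /M /double_star_mx !mxsimp zcz.
    by rewrite !scale1r scale_scalar_mx mulr1 addr_scalar subrr raddf0 col_mx0.
  have := MP_cancel_left MP (c := c).
  rewrite cM !ctmx_col !ctmx0 /M /double_star_mx !mxsimp.
  rewrite hdotE e0 raddf0 !row_mx0.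
  move/(_ erefl)=> r0.
  by have := congr1 (fun r => dsubmx (usubmx r)) r0;
    rewrite col_mxKu col_mxKd !linear0.
- move/eqP: z0; apply; apply: trmx_inj; rewrite trmx0.
  set c : 'rV_((1 + m) + (1 + n)) := row_mx (row_mx 0 cy^T) (row_mx 1%:M 0).
  have cM : c *m M = row_mx 0 (row_mx 0 z^T).
    rewrite /c /M /double_star_mx !mxsimp (trdot _ _ _ _ ycy).
    by rewrite !scale1r addr_scalar addNr raddf0 row_mx0.
  have := MP_cancel_right MP (c := c).
  rewrite cM !ctmx_row !ctmx0 /M /double_star_mx !mxsimp.
  rewrite hdot_trE e0 raddf0 !col_mx0.
  move/(_ erefl)=> r0.
  by have := congr1 (fun r => rsubmx (rsubmx r)) r0;
    rewrite !row_mxKr !linear0.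
- move/eqP: w0; apply.
  set c : 'cV_((1 + m) + (1 + n)) := col_mx (col_mx 0 cx) (col_mx 1%:M 0).
  have cM : M *m c = col_mx 0 (col_mx 0 w).
    rewrite /c /M /double_star_mx !mxsimp xcx.
    by rewrite !scale1r scale_scalar_mx mulr1 addr_scalar addNr raddf0 col_mx0.
  have := MP_cancel_left MP (c := c).
  rewrite cM !ctmx_col !ctmx0 /M /double_star_mx !mxsimp.
  rewrite hdotE e0 raddf0 !row_mx0.
  move/(_ erefl)=> r0.
  by have := congr1 (fun r => dsubmx (dsubmx r)) r0;
    rewrite !col_mxKd !linear0.
Qed.

Theorem lemma6p4 (F : fieldType) (conj : involutive_rmorphism F) (m n : nat)
  (x y : 'cV[F]_m) (z w : 'cV[F]_n) (a b : F)
  (hm : (1 <= m)%N) (hn : (1 <= n)%N)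
  (hx : forall i, x i ord0 != 0) (hy : forall i, y i ord0 != 0)
  (hz : forall i, z i ord0 != 0) (hw : forall i, w i ord0 != 0)
  (ha : a != 0) (hb : b != 0)
  (hxy : bdot x y != 0) (hzw : bdot z w = 0)
  (hzeta : bdot x y + a * b != 0) :
  let M := double_star_mx x y z w a b in
  let zeta := bdot x y + a * b in
  let s := hdot conj x x in
  let u := hdot conj y y in
  let t := hdot conj z z in
  let v := hdot conj w w in
  let q := a * conj a + s in
  let alpha := zeta * conj zeta + a * conj a * t in
  ((MP_invertible conj M /\ dual_core_EP_invertible conj M) <->
   [/\ s != 0, u != 0 & t != 0] /\ [/\ v != 0, q != 0 & alpha != 0]) /\
  (MP_invertible conj M -> dual_core_EP_invertible conj M ->
   unique (is_GC_inverse conj M)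
     (block_mx
        (block_mx 0
                  (((u * zeta)^-1 * bdot x y) *: ctmx conj y)
                  ((alpha^-1 * conj zeta) *: y)
                  0)
        (block_mx (a * zeta^-1)%:M
                  0
                  0
                  0)
        (block_mx (alpha^-1 * (b * conj zeta + conj a * t))%:M
                  0
                  0
                  ((conj a * (u * q * zeta)^-1 * bdot x y)
                     *: (w *m ctmx conj y)))
        (block_mx 0
                  0
                  ((a * conj a * (q * zeta)^-1) *: w)
                  0))).
Proof.
move=> M zeta s u t v q alpha.
have nonzero p (c : 'cV[F]_p) :
    (1 <= p)%N -> (forall i, c i ord0 != 0) -> c != 0.
  by move=> hp hc; apply/cV0Pn; exists (Ordinal hp).
have necessary : MP_invertible conj M -> dual_core_EP_invertible conj M ->
    [/\ s != 0, u != 0 & t != 0] /\ [/\ v != 0, q != 0 & alpha != 0].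
  move=> MP EP.
  have [s0 u0 t0 v0] := star_MP_necessary (nonzero _ _ hm hx)
    (nonzero _ _ hm hy) (nonzero _ _ hn hz) (nonzero _ _ hn hw) MP.
  by have [q0 alpha0] := star_dual_core_EP_necessary hzw hzeta ha EP.
split; first split.
- by case; apply: necessary.
- move=> [[s0 u0 t0] [v0 q0 alpha0]]; split.
    by eexists; apply: star_pinvP.
  by eexists; apply: star_dual_core_EPP.
- move=> MP EP; have [[s0 u0 t0] [v0 q0 alpha0]] := necessary MP EP.
  rewrite -(star_GCE s0 u0 t0 v0 hzeta q0 alpha0).
  by apply: GC_inverse_unique; [apply: star_pinvP|apply: star_dual_core_EPP].
Qed.
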